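(* Let $p,q\in(1,\infty)$ and $r,s\in(0,1)$. Then all of the following inequalities hold: $$\sin_{p,q}\sqrt{rs}\ \ge\ \sqrt{\sin_{p,q}(r)\,\sin_{p,q}(s)},\qquad \sinh_{p,q}\sqrt{rs}\ \le\ \sqrt{\sinh_{p,q}(r)\,\sinh_{p,q}(s)},$$ $$\sin_{p}\sqrt{rs}\ \ge\ \sqrt{\sin_{p}(r)\,\sin_{p}(s)},\qquad \sinh_{p}\sqrt{rs}\ \le\ \sqrt{\sinh_{p}(r)\,\sinh_{p}(s)}.$$
   Context: For $p,q>1$ define $\arcsin_{p,q}(x)=\int_0^x(1-t^q)^{-1/p}\,dt$ for $x\in[0,1]$ and $\frac{\pi_{p,q}}{2}=\int_0^1(1-t^q)^{-1/p}\,dt$. Then $\arcsin_{p,q}:[0,1]\to[0,\frac{\pi_{p,q}}{2}]$ is an increasing homeomorphism, and $\sin_{p,q}:[0,\frac{\pi_{p,q}}{2}]\to[0,1]$ denotes its inverse. Define also $\operatorname{arcsinh}_{p,q}(x)=\int_0^x(1+t^q)^{-1/p}\,dt$ for $x\in(0,\infty)$ and $m^*_{p,q}=\int_0^\infty(1+t^q)^{-1/p}\,dt\in(0,\infty]$. The function $\sinh_{p,q}:(0,m^*_{p,q})\to(0,\infty)$ denotes the inverse of $\operatorname{arcsinh}_{p,q}$. Both domains $(0,\frac{\pi_{p,q}}{2})$ and $(0,m^*_{p,q})$ contain $(0,1)$. When $p=q$ one writes $\sin_p=\sin_{p,p}$ and $\sinh_p=\sinh_{p,p}$. *)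

(* Defs.v *)
From HB Require Import structures.
From mathcomp Require Import all_boot all_order all_algebra.
From mathcomp Require Import all_classical all_reals all_analysis.
Set Implicit Arguments.
Unset Strict Implicit.
Unset Printing Implicit Defensive.
Import Order.TTheory GRing.Theory Num.Theory.
Import numFieldNormedType.Exports.
Local Open Scope classical_set_scope.
Local Open Scope ring_scope.

(* For x = 1 the integrand is singular at t = 1. The Lebesgue integral gives
   the (finite) improper integral pi_{p,q} / 2; the value of powR at 0 only
   affects the single point t = 1. *)
Definition arcsin_pq {R : realType} (p q x : R) : R :=
  \int[lebesgue_measure]_(t in `[0, x]) (1 - t `^ q) `^ (- p^-1).

Definition arcsinh_pq {R : realType} (p q x : R) : R :=
  \int[lebesgue_measure]_(t in `[0, x]) (1 + t `^ q) `^ (- p^-1).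

(* 'pinv_d A f is the inverse of f restricted to A, defined on the image
   f @` A and extended by d elsewhere. For p, q > 1, arcsin_pq is injective on
   [0, 1] with image [0, pi_{p,q} / 2], and arcsinh_pq is injective on
   (0, +oo) with image (0, m*_{p,q}); both images contain (0, 1). *)
Definition sin_pq {R : realType} (p q : R) : R -> R :=
  'pinv_(fun=> 0) `[0, 1] (arcsin_pq p q).

Definition sinh_pq {R : realType} (p q : R) : R -> R :=
  'pinv_(fun=> 0) `]0, +oo[ (arcsinh_pq p q).

Definition sin_p {R : realType} (p : R) : R -> R := sin_pq p p.

Definition sinh_p {R : realType} (p : R) : R -> R := sinh_pq p p.

(* Main.v *)
Require Import Defs.
From HB Require Import structures.
From mathcomp Require Import all_boot all_order all_algebra.
From mathcomp Require Import all_classical all_reals all_analysis.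
From mathcomp Require Import measurable_realfun ring lra.
Import Order.TTheory GRing.Theory Num.Theory.
Import numFieldNormedType.Exports.
Local Open Scope ring_scope.

(** Both families of inequalities are statements about the primitives
    [F x = \int_0^x f] of the kernels [f t = (1 + e t^q)^(-1/p)], with [e = -1]
    for arcsin and [e = 1] for arcsinh.  Since [F] is increasing, the inequality
    for its inverse follows from comparing [F (sqrt (x y))] with
    [sqrt (F x * F y)]: what has to be shown is that [u |-> ln (F (exp u))] is
    convex for [e = -1] and concave for [e = 1].

    This is proved without differentiating.  Given [0 < x <= y], put
    [l = sqrt (y / x)], so that [sqrt (x y) = l x] and [y = l (l x)].  By the
    substitution [t |-> l t] (lemma [Rintegral_scale]), [F (l x) / F x] is the
    ratio of the integrals of [g t = l f (l t)] and of [f] over [[0, x]], while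
    [F y / F (l x)] is the ratio of the same two integrals over [[0, l x]].  If
    the quotient [g / f] is monotone, so is the ratio of the primitives
    (lemma [Rintegral_ratio_nonincreasing], an integral form of the monotone
    L'Hospital rule), and this compares [F x * F y] with [F (l x) ^+ 2].
    For the kernels the monotonicity of [g / f] is the identity
    [pq_base_cross], in which the sign of [e] alone decides the direction.

    It remains to see that the inverses are genuine on [(0, 1)], that is, that
    the primitives take every value of [(0, 1)] in the right domain.
    For arcsin, [F x >= x] on [[0, 1[].  For arcsinh, the kernel dominates
    [(1 + t^q)^(-1/q - 1)], whose primitive [x (1 + x^q)^(-1/q)] has limit [1]
    at infinity. *)

Section PQTrigonometry.
Set Implicit Arguments.
Unset Strict Implicit.
Local Open Scope classical_set_scope.
Local Open Scope ring_scope.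
Context {R : realType}.
Implicit Types (f g : R -> R) (e p q a r s t u x y l : R).
Notation mu := (@lebesgue_measure R).

(** * Integrals over segments *)

Lemma within_itv_integrable f x y : {within `[x, y], continuous f} ->
  mu.-integrable `[x, y] (EFin \o f).
Proof.
by move=> cf; apply: continuous_compact_integrable => //; exact: segment_compact.
Qed.

Lemma Rintegral_split f x y : 0 <= x -> x <= y ->
  mu.-integrable `[0, y] (EFin \o f) ->
  \int[mu]_(t in `[0, y]) f t =
  \int[mu]_(t in `[0, x]) f t + \int[mu]_(t in `[x, y]) f t.
Proof.
move=> x0 xy fi.
have fxy : mu.-integrable `[x, y] (EFin \o f).
  by apply: integrableS fi => //; apply: subset_itvr; rewrite bnd_simp.
rewrite -Rintegral_itv_obnd_cbnd; last first.
  by apply: integrableS fxy => //; exact: subset_itv_oc_cc.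
rewrite -(Rintegral_itvB (a := BLeft 0) (b := BRight y)) ?bnd_simp//.
by rewrite addrC subrK.
Qed.

Lemma ltr_primitive f x y : 0 <= x -> x < y ->
  {within `[0, y], continuous f} -> {in `[0, y], forall t, 0 < f t} ->
  \int[mu]_(t in `[0, x]) f t < \int[mu]_(t in `[0, y]) f t.
Proof.
move=> x0 xy cf fpos.
have sub : `[x, y] `<=` `[0, y] by apply: subset_itvr; rewrite bnd_simp.
have cfxy : {within `[x, y], continuous f} by exact: continuous_subspaceW cf.
rewrite (Rintegral_split x0 (ltW xy) (within_itv_integrable cf)) ltrDl.
have [c cxy cmin] := EVT_min (ltW xy) cfxy.
have fc : 0 < f c by apply: fpos; exact: sub.
have : \int[mu]_(t in `[x, y]) f c <= \int[mu]_(t in `[x, y]) f t.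
  apply: le_Rintegral => //; last exact: within_itv_integrable.
  by apply: within_itv_integrable => ?; exact: cst_continuous.
apply: lt_le_trans.
by rewrite Rintegral_cst//= lebesgue_measure_itv/= lte_fin xy/= mulr_gt0// subr_gt0.
Qed.

Lemma Rintegral_scale f l x : 0 < l -> 0 <= x ->
  {within `[0, l * x], continuous f} ->
  \int[mu]_(t in `[0, l * x]) f t = \int[mu]_(t in `[0, x]) (l * f (l * t)).
Proof.
move=> l0 x0 cf.
have dF (t : R) : is_derive t 1 ( *%R l) l.
  by have := is_deriveZ l (is_derive_id t (1 : R^o)); rewrite /GRing.scale/= mulr1.
have F' : (( *%R l)^`())%classic = cst l.
  by apply/funext => t; rewrite derive1E derive_val.
have cF : continuous ( *%R l) by exact: mulrl_continuous.
have := @integration_by_substitution_increasing R ( *%R l) f 0 x x0.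
rewrite /Rintegral mulr0 => ->//.
- by congr fine; apply: eq_integral => t _; rewrite F' /= mulrC.
- by move=> t u _ _ tu; rewrite ltr_pM2l.
- by rewrite F' => ? _; exact: cst_continuous.
- by rewrite F'; exact: is_cvg_cst.
- by rewrite F'; exact: is_cvg_cst.
- split=> [t _||]; first exact: ex_derive.
  + by apply: cvg_at_right_filter; exact: cF.
  + by apply: cvg_at_left_filter; exact: cF.
Qed.

(** Monotone ratios integrate to monotone ratios: a weighted mean of [g / f]
    over [[0, x]] is at least [g x / f x], which is at least any weighted mean
    over [[x, y]].  The hypothesis and the conclusion are cross-multiplied so
    that no quotient occurs. *)
Lemma Rintegral_ratio_nonincreasing f g x y : 0 <= x -> x <= y ->
  mu.-integrable `[0, y] (EFin \o f) -> mu.-integrable `[0, y] (EFin \o g) ->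
  {in `[0, y], forall t, 0 <= f t} -> 0 < f x ->
  (forall t u, 0 <= t -> t <= u -> u <= y -> f t * g u <= g t * f u) ->
  \int[mu]_(t in `[0, x]) f t * \int[mu]_(t in `[0, y]) g t <=
  \int[mu]_(t in `[0, x]) g t * \int[mu]_(t in `[0, y]) f t.
Proof.
move=> x0 xy fi gi f0 fx fg.
rewrite (Rintegral_split x0 xy fi) (Rintegral_split x0 xy gi).
have sl : `[0, x] `<=` `[0, y] by apply: subset_itvl; rewrite bnd_simp.
have sr : `[x, y] `<=` `[0, y] by apply: subset_itvr; rewrite bnd_simp.
have il (h : R -> R) : mu.-integrable `[0, y] (EFin \o h) ->
    mu.-integrable `[0, x] (EFin \o h) by move=> hi; exact: integrableS hi.
have ir (h : R -> R) : mu.-integrable `[0, y] (EFin \o h) ->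
    mu.-integrable `[x, y] (EFin \o h) by move=> hi; exact: integrableS hi.
have scale (h : R -> R) (c a b : R) : mu.-integrable `[a, b] (EFin \o h) ->
    mu.-integrable `[a, b] (EFin \o (fun t => c * h t)).
  by move=> hi; exact: (@integrableZl _ _ _ mu _ (measurable_itv _) c _ hi).
(* Both comparisons are with the value of [g / f] at the splitting point [x]. *)
have low : g x * \int[mu]_(t in `[0, x]) f t <= f x * \int[mu]_(t in `[0, x]) g t.
  rewrite -!RintegralZl//; try exact: il.
  apply: le_Rintegral => //; [exact/scale/il..|].
  move=> t /=; rewrite in_itv/= => /andP[t0 tx].
  by rewrite mulrC [leRHS]mulrC; exact: fg.
have upp : f x * \int[mu]_(t in `[x, y]) g t <= g x * \int[mu]_(t in `[x, y]) f t.
  rewrite -!RintegralZl//; try exact: ir.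
  apply: le_Rintegral => //; [exact/scale/ir..|].
  by move=> t /=; rewrite in_itv/= => /andP[xt ty]; exact: fg.
have A0 : 0 <= \int[mu]_(t in `[0, x]) f t.
  by apply: Rintegral_ge0 => t /sl tx; exact: f0.
have B0 : 0 <= \int[mu]_(t in `[x, y]) f t.
  by apply: Rintegral_ge0 => t /sr tx; exact: f0.
rewrite !mulrDr mulrC lerD2l -(ler_pM2l fx).
apply: (@le_trans _ _ (g x * (\int[mu]_(t in `[0, x]) f t * \int[mu]_(t in `[x, y]) f t))).
  by rewrite mulrCA [leRHS]mulrCA ler_wpM2l.
by rewrite !mulrA ler_wpM2r.
Qed.

(** * Primitives at points in geometric progression *)

Lemma within_continuous_scale f l x : 0 < l ->
  {within `[0, l * x], continuous f} ->
  {within `[0, x], continuous (fun t => l * f (l * t))}.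
Proof.
move=> l0 /subspace_continuousP cf; apply/subspace_continuousP => t tx.
have lE z : `[0, x]%classic z -> `[0, l * x]%classic (l * z).
  by rewrite /= !in_itv/= pmulr_rge0// ler_pM2l.
apply: cvgM; first exact: cvg_cst.
apply: (cvg_comp ( *%R l) f _ (cf _ (lE _ tx))) => P /(@mulrl_continuous _ l t).
rewrite /= /within/= !nbhs_simpl/= => tP.
by apply: filterS tP => z /= Pz /lE; exact: Pz.
Qed.

(** Rescaling turns [F (l x)] and [F (l (l x))] into the integrals of
    [t |-> l f (l t)] over [[0, x]] and [[0, l x]]; the ratio of these to [F x]
    and [F (l x)] is nonincreasing as soon as [f (l t) / f t] is. *)
Lemma primitive_ratio_concave f l x : 0 < l -> 0 <= x -> x <= l * x ->
  {within `[0, l * (l * x)], continuous f} ->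
  {in `[0, l * (l * x)], forall t, 0 < f t} ->
  (forall t u, 0 <= t -> t <= u -> u <= l * x ->
     f t * f (l * u) <= f (l * t) * f u) ->
  \int[mu]_(t in `[0, x]) f t * \int[mu]_(t in `[0, l * (l * x)]) f t <=
  (\int[mu]_(t in `[0, l * x]) f t) ^+ 2.
Proof.
move=> l0 x0 xlx cf fpos ffl.
have lx0 : 0 <= l * x by rewrite mulr_ge0// ltW.
have lxllx : l * x <= l * (l * x) by rewrite ler_pM2l.
have sub : `[0, l * x] `<=` `[0, l * (l * x)] by apply: subset_itvl; rewrite bnd_simp.
rewrite (Rintegral_scale l0 lx0 cf) expr2.
rewrite [X in _ <= X * _](Rintegral_scale l0 x0); last first.
  exact: continuous_subspaceW cf.
apply: Rintegral_ratio_nonincreasing => //.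
- exact/within_itv_integrable/(continuous_subspaceW sub).
- exact/within_itv_integrable/within_continuous_scale.
- by move=> t /sub tx; exact/ltW/fpos.
- by apply/fpos/sub; rewrite /= in_itv/= x0.
- by move=> t u t0 tu ux; rewrite mulrCA -mulrA ler_pM2l//; exact: ffl.
Qed.

(** Same argument with the roles of [f] and [t |-> l f (l t)] exchanged. *)
Lemma primitive_ratio_convex f l x : 0 < l -> 0 <= x -> x <= l * x ->
  {within `[0, l * (l * x)], continuous f} ->
  {in `[0, l * (l * x)], forall t, 0 < f t} ->
  (forall t u, 0 <= t -> t <= u -> u <= l * x ->
     f (l * t) * f u <= f t * f (l * u)) ->
  (\int[mu]_(t in `[0, l * x]) f t) ^+ 2 <=
  \int[mu]_(t in `[0, x]) f t * \int[mu]_(t in `[0, l * (l * x)]) f t.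
Proof.
move=> l0 x0 xlx cf fpos ffl.
have lx0 : 0 <= l * x by rewrite mulr_ge0// ltW.
have lxllx : l * x <= l * (l * x) by rewrite ler_pM2l.
have sub : `[0, l * x] `<=` `[0, l * (l * x)] by apply: subset_itvl; rewrite bnd_simp.
rewrite (Rintegral_scale l0 lx0 cf) expr2.
rewrite [X in X * _ <= _](Rintegral_scale l0 x0); last first.
  exact: continuous_subspaceW cf.
apply: Rintegral_ratio_nonincreasing => //.
- exact/within_itv_integrable/within_continuous_scale.
- exact/within_itv_integrable/(continuous_subspaceW sub).
- move=> t /[!in_itv]/= /andP[t0 tx]; rewrite mulr_ge0 ?(ltW l0)//.
  by apply/ltW/fpos; rewrite in_itv/= pmulr_rge0// t0/= ler_pM2l.
- by rewrite mulr_gt0// fpos// in_itv/= lx0.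
- by move=> t u t0 tu ux; rewrite mulrCA -mulrA ler_pM2l//; exact: ffl.
Qed.

(** * The kernels and their primitives *)

Definition pq_kernel e p q t : R := (1 + e * t `^ q) `^ (- p^-1).

(** [1 + e t^q] is monotone in [t], hence lies between [1] and its value at
    [y]; this treats both signs of [e] at once. *)
Lemma pq_base_gt0 e q y t : 0 < q -> 0 <= t -> t <= y -> 0 < 1 + e * y `^ q ->
  0 < 1 + e * t `^ q.
Proof.
move=> q0 t0 ty y1.
have tq : t `^ q <= y `^ q.
  by apply: ge0_ler_powR => //; rewrite ?nnegrE ?(ltW q0)// (le_trans t0).
have tq0 : 0 <= t `^ q by exact: powR_ge0.
have [e0|e0] := leP 0 e; first by rewrite ltr_pwDl// mulr_ge0.
by apply: lt_le_trans y1 _; rewrite lerD2l ler_nM2l.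
Qed.

Lemma pq_kernel_gt0 e p q y : 0 < q -> 0 < 1 + e * y `^ q ->
  {in `[0, y], forall t, 0 < pq_kernel e p q t}.
Proof.
move=> q0 y1 t /[!in_itv]/= /andP[t0 ty].
by rewrite powR_gt0// (pq_base_gt0 q0 t0 ty).
Qed.

Lemma powR_gt0_continuous a x : 0 < x -> {for x, continuous (fun t : R => t `^ a)}.
Proof.
move=> x0; apply/differentiable_continuous/derivable1_diffP.
by apply: derivable_powR; rewrite in_itv/= x0.
Qed.

(** Only continuity from the right holds at [0], because [t `^ q] equals [1]
    for [t < 0]. *)
Lemma powR_within_continuous q y : 0 < q ->
  {within `[0, y], continuous (fun t : R => t `^ q)}.
Proof.
move=> q0; apply/subspace_continuousP => t /= /[!in_itv]/= /andP[].
rewrite le_eqVlt => /predU1P[<-{t}|t0] ty; last first.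
  by apply: cvg_within_filter; exact: powR_gt0_continuous.
have cr : t `^ q @[t --> 0^'+] --> (0 : R) `^ q.
  by rewrite powR0 ?gt_eqF//; exact: powR_cvg0.
have := cvg_at_right_within cr; apply: cvg_trans.
by apply: cvg_app; apply: within_subset => z /=; rewrite in_itv/= => /andP[].
Qed.

Lemma pq_kernel_within_continuous e p q y : 0 < q -> 0 < 1 + e * y `^ q ->
  {within `[0, y], continuous (pq_kernel e p q)}.
Proof.
move=> q0 y1; apply/subspace_continuousP => t ty.
have /subspace_continuousP/(_ t ty) cq := @powR_within_continuous q y q0.
have ct : 1 + e * t' `^ q @[t' --> within `[0, y] (nbhs t)] --> 1 + e * t `^ q.
  by apply: cvgD; [exact: cvg_cst|apply: cvgM; [exact: cvg_cst|exact: cq]].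
apply: (cvg_comp _ (fun t : R => t `^ (- p^-1)) ct).
apply: powR_gt0_continuous.
by move: ty; rewrite /= in_itv/= => /andP[t0 ty]; exact: (pq_base_gt0 q0 t0 ty).
Qed.

Lemma pq_kernelM e p q t u : 0 < 1 + e * t `^ q -> 0 < 1 + e * u `^ q ->
  pq_kernel e p q t * pq_kernel e p q u =
  ((1 + e * t `^ q) * (1 + e * u `^ q)) `^ (- p^-1).
Proof. by move=> t0 u0; rewrite powRM// ltW. Qed.

Lemma ler_powRN p x y : 0 < p -> 0 < x -> x <= y -> y `^ (- p^-1) <= x `^ (- p^-1).
Proof.
move=> p0 x0 xy; have y0 := lt_le_trans x0 xy.
rewrite !powRN lef_pV2 ?posrE ?powR_gt0//.
by apply: ge0_ler_powR => //; rewrite ?nnegrE ?invr_ge0 ltW.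
Qed.

(** The sign of this difference decides whether [f (l t) / f t] increases or
    decreases for the kernel [f]. *)
Lemma pq_base_cross e q l t u : 0 <= l -> 0 <= t -> 0 <= u ->
  (1 + e * (l * u) `^ q) * (1 + e * t `^ q) -
  (1 + e * (l * t) `^ q) * (1 + e * u `^ q) =
  e * ((l `^ q - 1) * (u `^ q - t `^ q)).
Proof. by move=> l0 t0 u0; rewrite !powRM//; ring. Qed.

Definition pq_primitive e p q x : R := \int[mu]_(t in `[0, x]) pq_kernel e p q t.

Lemma sqrt_ratio x y : 0 < x -> x <= y -> exists l, [/\ 1 <= l,
  Num.sqrt (x * y) = l * x & y = l * (l * x)].
Proof.
move=> x0 xy; have y0 := lt_le_trans x0 xy.
exists (Num.sqrt (y / x)); split.
- by rewrite -sqrtr1 ler_wsqrtr// ler_pdivlMr// mul1r.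
- have -> : x * y = y / x * x ^+ 2 by field; rewrite gt_eqF.
  by rewrite sqrtrM ?divr_ge0 ?ltW// sqrtr_sqr gtr0_norm.
- by rewrite mulrA -expr2 sqr_sqrtr ?divr_ge0 ?ltW// divfK// gt_eqF.
Qed.

Lemma pq_cross_ge0 q l t u : 0 < q -> 1 <= l -> 0 <= t -> t <= u ->
  0 <= (l `^ q - 1) * (u `^ q - t `^ q).
Proof.
move=> q0 l1 t0 tu; rewrite mulr_ge0// subr_ge0.
  suff : 1 `^ q <= l `^ q by rewrite powR1.
  apply: ge0_ler_powR => //.
  - exact: ltW.
  - by rewrite nnegrE.
  - by rewrite nnegrE (le_trans _ l1).
by apply: ge0_ler_powR => //; rewrite ?nnegrE ?(ltW q0)// (le_trans t0).
Qed.

(** [e >= 0] makes the cross difference of [pq_base_cross] nonnegative, and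
    raising both products of bases to the negative power [-1/p] reverses their
    order. *)
Lemma pq_primitive_geo_concave e p q x y : 0 < p -> 0 < q -> 0 <= e ->
  0 < x -> 0 < y ->
  pq_primitive e p q x * pq_primitive e p q y <=
  (pq_primitive e p q (Num.sqrt (x * y))) ^+ 2.
Proof.
move=> p0 q0 e0; wlog xy : x y / x <= y.
  move=> H x0 y0; have [xy|/ltW yx] := leP x y; first exact: H.
  by rewrite mulrC [x * y]mulrC; exact: H.
move=> x0 _; have [l [l1 -> {y xy}->]] := sqrt_ratio x0 xy.
have l0 : 0 < l by exact: lt_le_trans l1.
have bpos z : 0 < 1 + e * z `^ q by rewrite ltr_pwDl// mulr_ge0// powR_ge0.
apply: (@primitive_ratio_concave (pq_kernel e p q) l x l0);
  [exact: ltW|by rewrite ler_peMl// ltW|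
  exact: pq_kernel_within_continuous|exact: pq_kernel_gt0|].
move=> t u t0 tu _; have u0 := le_trans t0 tu.
rewrite (pq_kernelM p (bpos t) (bpos (l * u))).
rewrite (pq_kernelM p (bpos (l * t)) (bpos u)).
apply: ler_powRN => //; first by rewrite mulr_gt0.
rewrite -subr_ge0 [X in 0 <= X - _]mulrC pq_base_cross ?(ltW l0)//.
by rewrite mulr_ge0// pq_cross_ge0.
Qed.

(** For [e < 0] the base vanishes at a finite point; its positivity at [x] and
    [y] keeps the whole segment on the regular side of that point. *)
Lemma pq_primitive_geo_convex e p q x y : 0 < p -> 0 < q -> e <= 0 ->
  0 < x -> 0 < y -> 0 < 1 + e * x `^ q -> 0 < 1 + e * y `^ q ->
  (pq_primitive e p q (Num.sqrt (x * y))) ^+ 2 <=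
  pq_primitive e p q x * pq_primitive e p q y.
Proof.
move=> p0 q0 e0; wlog xy : x y / x <= y.
  move=> H x0 y0 bx bz; have [xy|/ltW yx] := leP x y; first exact: H.
  by rewrite [leRHS]mulrC [x * y]mulrC; exact: H.
move=> x0 _ _; have [l [l1 -> {y xy}->]] := sqrt_ratio x0 xy => bl.
have l0 : 0 < l by exact: lt_le_trans l1.
have bpos z : 0 <= z -> z <= l * (l * x) -> 0 < 1 + e * z `^ q.
  by move=> z0 zl; exact: pq_base_gt0 bl.
have lx : l * x <= l * (l * x) by rewrite ler_peMl// mulr_ge0 ?ltW.
apply: (@primitive_ratio_convex (pq_kernel e p q) l x l0);
  [exact: ltW|by rewrite ler_peMl// ltW|
  exact: pq_kernel_within_continuous|exact: pq_kernel_gt0|].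
move=> t u t0 tu ux; have u0 := le_trans t0 tu.
have bt : 0 < 1 + e * t `^ q by apply: bpos => //; lra.
have bu : 0 < 1 + e * u `^ q by apply: bpos => //; lra.
have blt : 0 < 1 + e * (l * t) `^ q.
  by apply: bpos; [rewrite mulr_ge0// ltW|rewrite ler_pM2l//; lra].
have blu : 0 < 1 + e * (l * u) `^ q.
  by apply: bpos; [rewrite mulr_ge0// ltW|rewrite ler_pM2l//; lra].
rewrite (pq_kernelM p blt bu) (pq_kernelM p bt blu).
apply: ler_powRN => //; first by rewrite mulr_gt0.
rewrite -subr_le0 [X in X - _ <= 0]mulrC pq_base_cross ?(ltW l0)//.
by rewrite mulr_le0_ge0// pq_cross_ge0.
Qed.

Lemma ltr_pq_primitive e p q x y : 0 < q -> 0 <= x -> x < y ->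
  0 < 1 + e * y `^ q -> pq_primitive e p q x < pq_primitive e p q y.
Proof.
move=> q0 x0 xy y1; apply: ltr_primitive => //.
- exact: pq_kernel_within_continuous.
- exact: pq_kernel_gt0.
Qed.

Lemma pq_primitive_ivt e p q y r : 0 < q -> 0 <= y -> 0 < 1 + e * y `^ q ->
  0 < r -> r <= pq_primitive e p q y ->
  exists x, [/\ 0 < x, x <= y & pq_primitive e p q x = r].
Proof.
move=> q0 y0 y1 r0 ry.
have P0 : pq_primitive e p q 0 = 0 by rewrite /pq_primitive set_itv1 Rintegral_set1.
have cP : {within `[0, y], continuous (pq_primitive e p q)}.
  apply: parameterized_integral_continuous => //.
  exact/within_itv_integrable/pq_kernel_within_continuous.
have [|x /[!in_itv]/= /andP[x0 xy] Px] := IVT (v := r) y0 cP.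
  have Py : 0 <= pq_primitive e p q y by apply: le_trans ry; exact: ltW.
  by rewrite P0 min_l// max_r// ltW.
exists x; split=> //; rewrite lt_neqAle x0 andbT; apply/eqP => x0'.
by move: r0; rewrite -Px -x0' P0 ltxx.
Qed.

(** * Values of arcsin and arcsinh *)

Lemma arcsin_pqE p q : @arcsin_pq R p q = pq_primitive (-1) p q.
Proof.
apply/funext => x; apply: eq_Rintegral => t _.
by rewrite /pq_kernel mulN1r.
Qed.

Lemma arcsinh_pqE p q : @arcsinh_pq R p q = pq_primitive 1 p q.
Proof.
apply/funext => x; apply: eq_Rintegral => t _.
by rewrite /pq_kernel mul1r.
Qed.

Lemma sin_base_gt0 q x : 0 < q -> 0 <= x -> x < 1 -> 0 < 1 + -1 * x `^ q.
Proof.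
move=> q0 x0 x1; rewrite mulN1r subr_gt0.
suff : x `^ q < 1 `^ q by rewrite powR1.
by apply: gt0_ltr_powR => //; rewrite nnegrE.
Qed.

Lemma le_arcsin_pq p q x : 0 < p -> 0 < q -> 0 <= x -> x < 1 ->
  x <= arcsin_pq p q x.
Proof.
move=> p0 q0 x0 x1; rewrite arcsin_pqE /pq_primitive.
have b0 := sin_base_gt0 q0 x0 x1.
suff : \int[mu]_(t in `[0, x]) 1 <= \int[mu]_(t in `[0, x]) pq_kernel (-1) p q t.
  apply: le_trans; rewrite Rintegral_cst//= lebesgue_measure_itv/= lte_fin.
  by case: ltP => /= x0'; lra.
apply: le_Rintegral => //.
- by apply: within_itv_integrable => ?; exact: cst_continuous.
- exact/within_itv_integrable/pq_kernel_within_continuous.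
move=> t /=; rewrite in_itv/= => /andP[t0 tx].
have bt := pq_base_gt0 q0 t0 tx b0.
suff : 1 `^ (- p^-1) <= pq_kernel (-1) p q t by rewrite powR1.
apply: ler_powRN; [exact: p0|exact: bt|].
by rewrite mulN1r lerBlDr lerDl powR_ge0.
Qed.

(** Rules out the endpoint [1] as a preimage of [r < 1].  The kernel is singular
    there, but either its integral is infinite and its real value is [0], or it
    is at least [F x] for every [x < 1], and [F x >= x] exceeds [r] for a
    suitable [x]. *)
Lemma arcsin_pq1 p q r : 0 < p -> 0 < q -> 0 < r -> r < 1 -> arcsin_pq p q 1 <> r.
Proof.
move=> p0 q0 r0 r1.
pose x := (r + 1) / 2.
have x0 : 0 <= x by rewrite /x; lra.
have x1 : x < 1 by rewrite /x; lra.
have rx : r < x by rewrite /x; lra.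
have b0 := sin_base_gt0 q0 x0 x1.
have le_int : (\int[mu]_(t in `[0%R, x]) (pq_kernel (-1) p q t)%:E <=
               \int[mu]_(t in `[0%R, 1%R]) (pq_kernel (-1) p q t)%:E)%E.
  apply: ge0_subset_integral => //.
  - apply/measurable_EFinP; apply: measurable_funTS.
    apply: (measurableT_comp (measurable_powR _)).
    apply: measurable_funD => //; apply: measurable_funM => //.
  - by move=> t _; rewrite lee_fin powR_ge0.
  - by apply: subset_itvl; rewrite bnd_simp ltW.
have fx : (\int[mu]_(t in `[0%R, x]) (pq_kernel (-1) p q t)%:E)%E \is a fin_num.
  apply: integrable_fin_num => //.
  exact/within_itv_integrable/pq_kernel_within_continuous.
have := le_arcsin_pq p0 q0 x0 x1.
rewrite !arcsin_pqE /pq_primitive /Rintegral.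
move: fx le_int; case: (integral _ _ _) => // v _.
case: (integral _ _ _) => [w|_ _|] //=; last by lra.
by rewrite lee_fin => vw xv; lra.
Qed.

(** The inverse is a choice of preimage in [[0, 1]]; the endpoint values of
    arcsin place it in the open interval, where the kernel is regular. *)
Lemma sin_pqP p q r : 0 < p -> 0 < q -> 0 < r -> r < 1 ->
  [/\ 0 < sin_pq p q r, sin_pq p q r < 1 & arcsin_pq p q (sin_pq p q r) = r].
Proof.
move=> p0 q0 r0 r1.
pose y := (r + 1) / 2.
have y0 : 0 <= y by rewrite /y; lra.
have y1 : y < 1 by rewrite /y; lra.
have ry : r <= pq_primitive (-1) p q y.
  by rewrite -arcsin_pqE (le_trans _ (le_arcsin_pq p0 q0 y0 y1))// /y; lra.
have [x [x0 xy Px]] := pq_primitive_ivt q0 y0 (sin_base_gt0 q0 y0 y1) r0 ry.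
have rim : (arcsin_pq p q @` `[0, 1]%classic) r.
  by exists x; [rewrite /= in_itv/=; lra|rewrite arcsin_pqE].
have rK : arcsin_pq p q (sin_pq p q r) = r.
  by rewrite /sin_pq pinvK// inE.
have : `[0, 1]%classic (sin_pq p q r).
  apply: (@surjpinv_image_sub _ _ (fun=> 0) _
    (arcsin_pq p q @` `[0, 1]%classic) (arcsin_pq p q)) => //.
  by exists r.
rewrite /= in_itv/= => /andP[S0 S1]; split=> //.
- rewrite lt_neqAle S0 andbT; apply/eqP => S0'.
  move: r0; rewrite -rK -S0' arcsin_pqE /pq_primitive set_itv1.
  by rewrite Rintegral_set1 ltxx.
- rewrite lt_neqAle S1 andbT; apply/eqP => S1'.
  by move: rK; rewrite S1'; exact: arcsin_pq1.
Qed.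

(** In the language of the kernels,
    [(t (1 + t^q)^(-1/q))' = (1 + t^q)^(-1/q - 1)]. *)
Lemma is_derive_pq_kernel_antiderivative q t : 0 < q -> 0 < t ->
  is_derive t 1 (fun z : R => z * pq_kernel 1 q q z)
    (pq_kernel 1 (q^-1 + 1)^-1 q t).
Proof.
move=> q0 t0.
have b0 : 0 < 1 + 1 * t `^ q by rewrite mul1r ltr_pwDl// powR_ge0.
have db : is_derive t 1 (fun z : R => 1 + 1 * z `^ q) (q * t `^ (q - 1)).
  have dq := is_derive1_powR q t0.
  have := is_deriveD (is_derive_cst (1 : R) t 1) (is_deriveZ (1 : R) dq).
  by rewrite add0r scale1r.
have dk := @is_derive1_comp R (fun z => z `^ (- q^-1)) (fun z => 1 + 1 * z `^ q) t
  _ _ (is_derive1_powR (- q^-1) b0) db.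
have := is_deriveM (is_derive_id t (1 : R)) dk.
rewrite /GRing.scale/= mulr1 /pq_kernel /comp invrK.
set b := 1 + 1 * t `^ q in b0 *.
rewrite opprD powRB ?(gt_eqF b0) ?implybT// powRr1 ?(ltW b0)//.
have -> : t * (- q^-1 * (b `^ (- q^-1) / b) * (q * t `^ (q - 1))) + b `^ (- q^-1) =
    b `^ (- q^-1) / b * (b - t * t `^ (q - 1)).
  by field; rewrite !gt_eqF.
rewrite mulr_powRB1 ?(ltW t0)//.
have -> : b - t `^ q = 1 by rewrite /b; ring.
by rewrite mulr1.
Qed.

(** [p > 1] gives [1/p < 1 + 1/q], so the kernel of arcsinh dominates the
    derivative of [t (1 + t^q)^(-1/q)]. *)
Lemma arcsinh_pq_lower_bound p q y : 1 < p -> 0 < q -> 0 < y ->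
  y * pq_kernel 1 q q y <= arcsinh_pq p q y.
Proof.
move=> p1 q0 y0.
have bpos z : 0 < 1 + 1 * z `^ q :> R by rewrite mul1r ltr_pwDl// powR_ge0.
have ck a := @pq_kernel_within_continuous 1 a q y q0 (bpos y).
pose H z : R := z * pq_kernel 1 q q z.
have cH : {within `[0, y], continuous H}.
  move=> z; apply: cvgM; last exact: ck.
  by apply: continuous_subspaceT => ? ; exact: cvg_id.
have dH z : z \in `]0, y[ -> is_derive z 1 H (pq_kernel 1 (q^-1 + 1)^-1 q z).
  move=> /[!in_itv]/= /andP[z0 _].
  exact: is_derive_pq_kernel_antiderivative.
have -> : y * pq_kernel 1 q q y =
    \int[mu]_(t in `[0, y]) pq_kernel 1 (q^-1 + 1)^-1 q t.
  rewrite /Rintegral (@continuous_FTC2 _ _ H)//=; first by rewrite /H mul0r subr0.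
  - have /(continuous_within_itvP _ y0)[_ H0 Hy] := cH.
    split=> [z /dH zH||]; [|exact: H0|exact: Hy].
    exact: (@ex_derive _ _ _ _ _ _ _ zH).
  - by move=> z /dH zH; rewrite derive1E derive_val.
rewrite arcsinh_pqE; apply: le_Rintegral => //; [exact: within_itv_integrable..|].
move=> t _; rewrite /pq_kernel invrK ler_powR//.
  by rewrite mul1r lerDl powR_ge0.
rewrite lerN2; have : p^-1 <= 1 by rewrite invf_le1 ?ltW// (lt_trans _ p1).
by have : 0 < q^-1 by [rewrite invr_gt0]; lra.
Qed.

Lemma arcsinh_pq_ge p q s : 1 < p -> 0 < q -> 0 < s -> s < 1 ->
  exists2 y, 0 <= y & s <= arcsinh_pq p q y.
Proof.
move=> p1 q0 s0 s1; have := sin_base_gt0 q0 (ltW s0) s1.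
rewrite mulN1r; set c := 1 - s `^ q => c0.
have y0 : 0 < s * c `^ (- q^-1) by rewrite mulr_gt0// powR_gt0.
(* The solution [y] of [y (1 + y^q)^(-1/q) = s]. *)
exists (s * c `^ (- q^-1)); first exact: ltW.
apply: le_trans (arcsinh_pq_lower_bound p1 q0 y0).
rewrite /pq_kernel powRM ?powR_ge0 ?(ltW s0)// -powRrM mulNr mulVf ?gt_eqF//.
rewrite powR_inv1 ?(ltW c0)// (_ : 1 + 1 * (s `^ q / c) = c^-1); last first.
  by rewrite (_ : s `^ q = 1 - c); [field; rewrite gt_eqF|rewrite /c; ring].
rewrite -mulrA -powRM ?invr_ge0 ?(ltW c0)// mulfV ?gt_eqF// powR1 mulr1.
exact: lexx.
Qed.

Lemma sinh_pqP p q r : 1 < p -> 0 < q -> 0 < r -> r < 1 ->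
  0 < sinh_pq p q r /\ arcsinh_pq p q (sinh_pq p q r) = r.
Proof.
move=> p1 q0 r0 r1; have [y y0 ry] := arcsinh_pq_ge p1 q0 r0 r1.
have b0 : 0 < 1 + 1 * y `^ q by rewrite mul1r ltr_pwDl// powR_ge0.
rewrite arcsinh_pqE in ry.
have [x [x0 xy Px]] := pq_primitive_ivt q0 y0 b0 r0 ry.
have rim : (arcsinh_pq p q @` `]0, +oo[%classic) r.
  by exists x; [rewrite /= in_itv/= x0|rewrite arcsinh_pqE].
split; last by rewrite /sinh_pq pinvK// inE.
have : `]0, +oo[%classic (sinh_pq p q r).
  apply: (@surjpinv_image_sub _ _ (fun=> 0) _
    (arcsinh_pq p q @` `]0, +oo[%classic) (arcsinh_pq p q)) => //.
  by exists r.
by rewrite /= in_itv/= andbT.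
Qed.

Lemma sqrt_mul_01 r s : 0 < r -> r < 1 -> 0 < s -> s < 1 ->
  0 < Num.sqrt (r * s) /\ Num.sqrt (r * s) < 1.
Proof.
move=> r0 r1 s0 s1; split; first by rewrite sqrtr_gt0 mulr_gt0.
by rewrite -sqrtr1 ltr_sqrt// mulr_ilt1// ltW.
Qed.

(** Applying the increasing function arcsin turns the claim into the
    log-log convexity of [pq_primitive_geo_convex] at the points [sin r] and
    [sin s]. *)
Lemma sin_pq_sqrt p q r s : 0 < p -> 0 < q ->
  0 < r -> r < 1 -> 0 < s -> s < 1 ->
  Num.sqrt (sin_pq p q r * sin_pq p q s) <= sin_pq p q (Num.sqrt (r * s)).
Proof.
move=> p0 q0 r0 r1 s0 s1; have [m0 m1] := sqrt_mul_01 r0 r1 s0 s1.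
have [Sr0 Sr1 rK] := sin_pqP p0 q0 r0 r1.
have [Ss0 Ss1 sK] := sin_pqP p0 q0 s0 s1.
have [Sm0 Sm1 mK] := sin_pqP p0 q0 m0 m1.
have [g0 g1] := sqrt_mul_01 Sr0 Sr1 Ss0 Ss1.
rewrite leNgt; apply/negP => /(ltr_pq_primitive p q0 (ltW Sm0)).
move=> /(_ (-1) (sin_base_gt0 q0 (ltW g0) g1)).
rewrite -arcsin_pqE mK ltNge => /negP; apply.
rewrite -[leLHS]ger0_norm; last exact/Rintegral_ge0/(fun t _ => powR_ge0 _ _).
rewrite -sqrtr_sqr ler_wsqrtr//
  (_ : r * s = arcsin_pq p q (sin_pq p q r) * arcsin_pq p q (sin_pq p q s));
  last by rewrite rK sK.
rewrite !arcsin_pqE.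
apply: (pq_primitive_geo_convex p0 q0 (lerN10 R) Sr0 Ss0).
- exact: (sin_base_gt0 q0 (ltW Sr0) Sr1).
- exact: (sin_base_gt0 q0 (ltW Ss0) Ss1).
Qed.

(** As for sin, from the log-log concavity of arcsinh. *)
Lemma sinh_pq_sqrt p q r s : 1 < p -> 0 < q ->
  0 < r -> r < 1 -> 0 < s -> s < 1 ->
  sinh_pq p q (Num.sqrt (r * s)) <= Num.sqrt (sinh_pq p q r * sinh_pq p q s).
Proof.
move=> p1 q0 r0 r1 s0 s1; have [m0 m1] := sqrt_mul_01 r0 r1 s0 s1.
have [Sr0 rK] := sinh_pqP p1 q0 r0 r1.
have [Ss0 sK] := sinh_pqP p1 q0 s0 s1.
have [Sm0 mK] := sinh_pqP p1 q0 m0 m1.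
have p0 : 0 < p by exact: lt_trans p1.
rewrite leNgt; apply/negP => /(ltr_pq_primitive p q0 (sqrtr_ge0 _)).
have b0 : 0 < 1 + 1 * sinh_pq p q (Num.sqrt (r * s)) `^ q.
  by rewrite mul1r ltr_pwDl// powR_ge0.
move=> /(_ 1 b0).
rewrite -arcsinh_pqE mK ltNge => /negP; apply.
rewrite -[leRHS]ger0_norm; last exact/Rintegral_ge0/(fun t _ => powR_ge0 _ _).
rewrite -sqrtr_sqr ler_wsqrtr//
  (_ : r * s = arcsinh_pq p q (sinh_pq p q r) * arcsinh_pq p q (sinh_pq p q s));
  last by rewrite rK sK.
rewrite !arcsinh_pqE.
exact: (pq_primitive_geo_concave p0 q0 ler01 Sr0 Ss0).
Qed.

End PQTrigonometry.

Theorem corollary1p1 (R : realType) (p q r s : R)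
  (hp : 1 < p) (hq : 1 < q)
  (hr0 : 0 < r) (hr1 : r < 1) (hs0 : 0 < s) (hs1 : s < 1) :
  [/\ sin_pq p q (Num.sqrt (r * s))
        >= Num.sqrt (sin_pq p q r * sin_pq p q s),
      sinh_pq p q (Num.sqrt (r * s))
        <= Num.sqrt (sinh_pq p q r * sinh_pq p q s),
      sin_p p (Num.sqrt (r * s))
        >= Num.sqrt (sin_p p r * sin_p p s)
    & sinh_p p (Num.sqrt (r * s))
        <= Num.sqrt (sinh_p p r * sinh_p p s)].
Proof.
have p0 : 0 < p by exact: lt_trans hp.
have q0 : 0 < q by exact: lt_trans hq.
by split; (exact: sin_pq_sqrt) || (exact: sinh_pq_sqrt).
Qed.
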